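(* Let $m\ge2$, let $\Omega\subset\mathbb R^m$ be open, $K=[-a,a]$ with $a>0$, and let $N\in C^1(\Omega\times K)$. Set $D_N(x,\lambda)=\partial_\lambda N(x,\lambda)$, $A_N=\{(x,\lambda)\in\Omega\times K: D_N(x,\lambda)\ne0\}$, $(A_N)_x=\{\lambda\in K:(x,\lambda)\in A_N\}$, $$\mathcal N_N(x,\lambda)=\bigl(N(x,\lambda)^2,\,N(x,\lambda),\,N(x,\lambda)^3,\ldots,N(x,\lambda)^m\bigr)\in\mathbb R^m,\qquad a_N(x,\lambda)=\partial_\lambda\mathcal N_N(x,\lambda).$$ Then for every $x\in\Omega$ and every $\xi\in\mathbb R^m\setminus\{0\}$, the function $\lambda\mapsto a_N(x,\lambda)\cdot\xi$ is not identically zero on any non-degenerate interval $J\Subset(A_N)_x$. Equivalently, $\lambda\mapsto\mathcal N_N(x,\lambda)\cdot\xi$ is not constant on any such interval.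
   Context: For $m=2$ the vector $\mathcal N_N$ is $(N^2,N)$. $J\Subset(A_N)_x$ means that the closure of $J$ is a compact subset of $(A_N)_x$; non-degenerate means with non-empty interior. *)

(* Defs.v *)
From HB Require Import structures.
From mathcomp Require Import all_boot all_order all_algebra.
From mathcomp Require Import all_classical all_reals all_analysis.
Import Order.TTheory GRing.Theory Num.Theory.
Import numFieldNormedType.Exports.

Set Implicit Arguments.
Unset Strict Implicit.
Unset Printing Implicit Defensive.

Local Open Scope classical_set_scope.
Local Open Scope ring_scope.

(* Derivatives in the parameter are taken along K: for K = [-a, a] this is the
   usual derivative in ]-a, a[ and the one-sided derivative at -a and at a, so
   that only the values of f on K are involved. *)
Section DerivativeWithin.
Variables (R : realType) (V : normedModType R).
Implicit Types (K : set R) (f : R -> V) (l : R).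

Definition diff_quot f l (mu : R) : V := (mu - l)^-1 *: (f mu - f l).

Definition derivable_within K f l : Prop :=
  cvg (diff_quot f l @ within K l^').

Definition derive_within K f l : V := lim (diff_quot f l @ within K l^').

End DerivativeWithin.

Section Parametrised.
Variables (R : realType) (m : nat).
Implicit Types (Omega : set 'rV[R]_m) (K : set R) (N : 'rV[R]_m * R -> R).

Definition dlambda (V : normedModType R) K (F : 'rV[R]_m * R -> V)
  (z : 'rV[R]_m * R) : V := derive_within K (fun l => F (z.1, l)) z.2.

Definition dx (i : 'I_m) N (z : 'rV[R]_m * R) : R :=
  'D_(delta_mx 0 i) (fun y => N (y, z.2)) z.1.

(* N is C^1 on Omega x K: all first order partial derivatives exist, and they
   and N are jointly continuous for the relative topology of Omega x K, hence
   up to the end points of K. *)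
Definition C1_on Omega K N : Prop :=
  [/\ {within Omega `*` K, continuous N},
      forall i z, (Omega `*` K) z ->
        derivable (fun y => N (y, z.2)) z.1 (delta_mx 0 i),
      forall i, {within Omega `*` K, continuous (dx i N)},
      forall z, (Omega `*` K) z ->
        derivable_within K (fun l => N (z.1, l)) z.2
    & {within Omega `*` K, continuous (dlambda K N)}].

Definition AN Omega K N : set ('rV[R]_m * R) :=
  [set z | (Omega `*` K) z /\ dlambda K N z != 0].

(* Coordinates are numbered from 0, and the first two powers are swapped. *)
Definition calN_exp (j : nat) : nat :=
  match j with 0 => 2 | 1 => 1 | _ => j.+1 end%N.

Definition calN N (z : 'rV[R]_m * R) : 'rV[R]_m :=
  \row_(j < m) N z ^+ calN_exp j.

Definition aN K N (z : 'rV[R]_m * R) : 'rV[R]_m := dlambda K (calN N) z.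

Definition dotp (u v : 'rV[R]_m) : R := \sum_(i < m) u 0 i * v 0 i.

End Parametrised.

Definition nondegenerate_interval (R : realType) (J : set R) : Prop :=
  is_interval J /\ J° !=set0.

Definition compactly_included (R : realType) (J A : set R) : Prop :=
  compact (closure J) /\ closure J `<=` A.

(* Main.v *)
Require Import Defs.
From HB Require Import structures.
From mathcomp Require Import all_boot all_order all_algebra.
From mathcomp Require Import all_classical all_reals all_analysis.
Import Order.TTheory GRing.Theory Num.Theory.
Import numFieldNormedType.Exports.
Local Open Scope classical_set_scope.
Local Open Scope ring_scope.

(** Fix [x] and write [f l = N (x, l)]. For [P = calNpoly xi], the sum of the
[xi_j 'X^e_j] over the exponents [e_j] of the components of [calN], the dot
product of [calN N (x, l)] with [xi] is [P.[f l]], and by the chain rule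
(lemma [dotp_aN]) that of [aN] with [xi] is [f' l * P^`().[f l]]. The exponents
are distinct and positive, so [xi != 0] makes both [P^`()] and [P - c%:P]
nonzero, whatever the constant [c].

On [J] the derivative [f'] does not vanish. Hence in either part of the theorem
the negation provides a nonzero polynomial [Q] with [Q.[f l] = 0] at all
interior points [l] of [J]. This is absurd already near a single interior point
[l0] (lemma [not_near_root]): the roots of [Q] are isolated, so continuity
forces [f] to stay at the value [f l0] near [l0], whereas [f' l0 != 0] forces
[f] to leave that value.

Working at interior points of [J], which are interior to [K], makes the
punctured neighbourhoods in [K] nondegenerate, so that limits along them are
unique. *)

Lemma within_dnbhs_proper (R : realType) (K : set R) (l : R) :
  K° l -> ProperFilter (within K l^').
Proof.
move=> Kl; split; last exact: within_filter.
rewrite /within /= => K'0.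
apply: (@filter_not_empty _ (l^')).
have lK : l^' K by exact: (nbhs_dnbhs Kl).
by apply: filterS2 lK K'0 => y Ky /(_ Ky).
Qed.

Section DiffQuot.
Variables (R : realType) (K : set R) (l : R).
Context {FF : ProperFilter (within K l^')}.

Lemma near_within_neq : \forall mu \near within K l^', mu - l != 0.
Proof.
rewrite near_withinE; near=> mu => _; rewrite subr_eq0.
by near: mu; exact: nbhs_dnbhs_neq.
Unshelve. all: by end_near. Qed.

Lemma cvg_within_id : mu @[mu --> within K l^'] --> l.
Proof. by apply: cvg_within_filter; exact: cvg_within. Qed.

(** Because [f mu = (mu - l) * diff_quot f l mu + f l] away from [l]. *)
Lemma diff_quot_cvg_continuous (f : R -> R) (d : R) :
  diff_quot f l @ within K l^' --> d -> f @ within K l^' --> f l.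
Proof.
move=> fd.
have h : ((mu - l) * diff_quot f l mu + f l) @[mu --> within K l^'] --> f l.
  (* The limit is written as [(l - l) * d + f l] to match the function. *)
  rewrite -[X in _ --> X]add0r -[X in _ --> X + _](mul0r d) -(subrr l).
  apply: cvgD; last exact: cvg_cst.
  apply: cvgM => //; apply: cvgB; [exact: cvg_within_id|exact: cvg_cst].
apply: cvg_trans h; apply: near_eq_cvg.
near=> mu; rewrite /diff_quot /= [_ *: _]/(_ * _) mulrA divff ?mul1r ?subrK//.
by near: mu; exact: near_within_neq.
Unshelve. all: by end_near. Qed.

(** The factorisation of [f mu ^+ n - f l ^+ n] by [f mu - f l] turns the
quotient of the power into that of [f] times a sum of [n] terms, each of which
tends to [f l ^+ n.-1]. *)
Lemma diff_quotX_cvg (f : R -> R) (d : R) (n : nat) :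
  diff_quot f l @ within K l^' --> d ->
  diff_quot (fun mu => f mu ^+ n) l @ within K l^' -->
    d * (f l ^+ n.-1 *+ n).
Proof.
move=> fd; have fc := diff_quot_cvg_continuous f d fd.
have -> : diff_quot (fun mu => f mu ^+ n) l =
    (fun mu => diff_quot f l mu * \sum_(i < n) f mu ^+ (n.-1 - i) * f l ^+ i).
  apply/funext => mu; rewrite /diff_quot /= ![_ *: _]/(_ * _) -mulrA.
  by rewrite subrXX; congr (_ * (_ * _)).
apply: cvgM => //.
have -> : f l ^+ n.-1 *+ n = \sum_(i < n) f l ^+ (n.-1 - i) * f l ^+ i.
  rewrite -[in LHS](card_ord n) -sumr_const; apply: eq_bigr => i _.
  rewrite -exprD subnK ?card_ord//.
  by rewrite -ltnS prednK// (leq_trans _ (ltn_ord i)).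
apply: cvg_big => [|i _]; first exact: add_continuous.
apply: cvgM; last exact: cvg_cst.
by have := cvg_comp _ _ fc (@exprn_continuous R (n.-1 - i)%N (f l)); exact.
Qed.

(** Limits of row vectors reduce to limits of scalars by expanding the rows on
the canonical basis. *)
Lemma diff_quot_row_cvg (m : nat) (f : 'I_m -> R -> R) (d : 'I_m -> R) :
  (forall j, diff_quot (f j) l @ within K l^' --> d j) ->
  diff_quot (fun mu => \row_j f j mu) l @ within K l^' --> \row_j d j.
Proof.
move=> fd; rewrite [X in _ --> X]row_sum_delta.
have -> : diff_quot (fun mu => \row_j f j mu) l =
    (fun mu => \sum_j diff_quot (f j) l mu *: (delta_mx 0 j : 'rV[R]_m)).
  apply/funext => mu; rewrite [LHS]row_sum_delta; apply: eq_bigr => j _.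
  by rewrite !mxE.
apply: cvg_big => [|j _]; [exact: add_continuous|rewrite mxE].
by apply: cvgZr_tmp; exact: fd.
Qed.

(** Write [Q = q * ('X - (f l)%:P) ^+ k] with [q.[f l] != 0]. Near [l] the
factor [q.[f mu]] is nonzero by continuity, so a root [f mu] of [Q] must equal
[f l]; then the difference quotient at [mu] is zero, although it tends to
[d != 0]. *)
Lemma not_near_root (f : R -> R) (d : R) (Q : {poly R}) :
  diff_quot f l @ within K l^' --> d -> d != 0 -> Q != 0 ->
  ~ (\forall mu \near within K l^', Q.[f mu] = 0).
Proof.
move=> fd d0 Q0 Qf.
have [k [q + Qq]] := multiplicity_XsubC Q (f l); rewrite Q0 /= => qfl.
have qc : q.[f mu] @[mu --> within K l^'] --> q.[f l].
  have fc := diff_quot_cvg_continuous f d fd.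
  by have := cvg_comp _ _ fc (@continuous_horner R q (f l)); exact.
have [mu []] : exists mu, [/\ Q.[f mu] = 0, q.[f mu] != 0 & diff_quot f l mu != 0].
  apply: (@filter_ex _ (within K l^')); near=> mu; split; near: mu => //.
    by apply: (cvgr_neq0 _ qc).
  by apply: (cvgr_neq0 _ fd).
rewrite Qq hornerM horner_exp !hornerE => /eqP; rewrite mulf_eq0 expf_eq0.
move=> /orP[->//|/andP[_ /eqP e]] _.
by rewrite /diff_quot e scaler0 eqxx.
Unshelve. all: by end_near. Qed.

End DiffQuot.

Section CalNPoly.
Variables (R : realType) (m : nat).

Definition calNpoly (xi : 'rV[R]_m) : {poly R} :=
  \sum_(j < m) xi 0 j *: 'X^(calN_exp j).

Lemma calN_exp_gt0 j : (0 < calN_exp j)%N.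
Proof. by case: j => [|[]]. Qed.

Lemma calN_exp_inj : injective calN_exp.
Proof. by case=> [|[|i]] [|[|j]] // [->]. Qed.

Lemma coef_calNpoly xi (j : 'I_m) : (calNpoly xi)`_(calN_exp j) = xi 0 j.
Proof.
rewrite /calNpoly coef_sum (bigD1 j)//= coefZ coefXn eqxx mulr1.
rewrite big1 ?addr0// => i ij; rewrite coefZ coefXn.
case: eqP => [/calN_exp_inj/val_inj ji|_]; last by rewrite mulr0.
by rewrite ji eqxx in ij.
Qed.

Lemma calNpoly_subC_neq0 xi c : xi != 0 -> calNpoly xi - c%:P != 0.
Proof.
apply: contra_neq => P0; apply/rowP => j; rewrite mxE -coef_calNpoly.
have := congr1 (fun p : {poly R} => p`_(calN_exp j)) P0.
by rewrite coefB coefC gtn_eqF ?calN_exp_gt0// subr0 coef0.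
Qed.

Lemma deriv_calNpoly_neq0 xi : xi != 0 -> (calNpoly xi)^`() != 0.
Proof.
apply: contra_neq => P0; apply/rowP => j; rewrite mxE -coef_calNpoly.
have := congr1 (fun p : {poly R} => p`_(calN_exp j).-1) P0.
rewrite coef_deriv coef0 prednK ?calN_exp_gt0// => /eqP.
by rewrite mulrn_eq0 gtn_eqF ?calN_exp_gt0// => /eqP.
Qed.

Lemma dotp_calN (N : 'rV[R]_m * R -> R) z xi :
  dotp (calN N z) xi = (calNpoly xi).[N z].
Proof.
rewrite /dotp /calNpoly horner_sum; apply: eq_bigr => j _.
by rewrite mxE !hornerE mulrC.
Qed.

(** The limit of vectors that defines [aN] is computed component by component;
the derivatives of the powers of [N] then assemble into that of [calNpoly xi].
*)
Lemma dotp_aN (K : set R) (N : 'rV[R]_m * R -> R) x l xi :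
  K° l -> derivable_within K (fun mu => N (x, mu)) l ->
  dotp (aN K N (x, l)) xi =
    dlambda K N (x, l) * (calNpoly xi)^`().[N (x, l)].
Proof.
move=> Kl dN; have FF := within_dnbhs_proper R K l Kl.
have -> : aN K N (x, l) = \row_(j < m)
    (dlambda K N (x, l) * (N (x, l) ^+ (calN_exp j).-1 *+ calN_exp j)).
  rewrite /aN {1}/dlambda; apply: cvg_lim => //.
  by apply: diff_quot_row_cvg => j; exact: diff_quotX_cvg.
rewrite /dotp /calNpoly raddf_sum horner_sum mulr_sumr; apply: eq_bigr => j _.
by rewrite mxE /= derivZ derivXn hornerZ hornerMn hornerXn -mulrA [xi 0 j * _]mulrC.
Qed.

End CalNPoly.

Theorem lemma2p9 (R : realType) (m : nat) (hm : (2 <= m)%N)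
  (Omega : set 'rV[R]_m) (hOmega : open Omega) (a : R) (ha : 0 < a)
  (N : 'rV[R]_m * R -> R) (hN : C1_on Omega `[- a, a]%classic N)
  (x : 'rV[R]_m) (hx : Omega x) (xi : 'rV[R]_m) (hxi : xi != 0)
  (J : set R) (hJ : nondegenerate_interval J)
  (hJA : compactly_included J (xsection (AN Omega `[- a, a]%classic N) x)) :
  ~ (forall l, J l -> dotp (aN `[- a, a]%classic N (x, l)) xi = 0) /\
  ~ (exists c : R, forall l, J l -> dotp (calN N (x, l)) xi = c).
Proof.
set K := `[- a, a]%classic in hN hJA *.
have [_ _ _ dN _] := hN; have [_ [l0 Jl0]] := hJ; have [_ JA] := hJA.
have A l : J l -> K l /\ dlambda K N (x, l) != 0.
  by move=> /subset_closure/JA; rewrite /xsection/= in_setE => -[[_ ?] ?].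
have JK : J° `<=` K° by apply: interiorS => l /A[].
have der l : J l -> derivable_within K (fun mu => N (x, mu)) l.
  by move=> /A[Kl _]; exact: (dN (x, l)).
have FF := within_dnbhs_proper R K l0 (JK _ Jl0).
have Jl : J l0 by exact: nbhs_singleton.
have noroot (Q : {poly R}) : Q != 0 -> ~ (forall l, J° l -> Q.[N (x, l)] = 0).
  move=> Q0 QJ; have [_ d0] := A l0 Jl.
  apply: (not_near_root R K l0 (fun l => N (x, l)) _ Q (der _ Jl) d0 Q0).
  apply: cvg_within; apply: nbhs_dnbhs.
  have : nbhs l0 J° by exact/nbhs_interior.
  by apply: filterS => l /QJ.
split=> [aN0|[c Nc]].
- apply: (noroot _ (deriv_calNpoly_neq0 R m xi hxi)) => l Jol.
  have Jl' : J l by exact: nbhs_singleton.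
  have /eqP := aN0 l Jl'; rewrite dotp_aN//; [|exact: JK|exact: der].
  by rewrite mulf_eq0 (negbTE (A l Jl').2) => /eqP.
- apply: (noroot _ (calNpoly_subC_neq0 R m xi c hxi)) => l Jol.
  have Jl' : J l by exact: nbhs_singleton.
  by rewrite !hornerE -dotp_calN Nc// subrr.
Qed.
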